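(* Let $k\in\mathbb{N}$ and let $n$ be an integer with $1\le n\le 2^k-1$. Write $n$ in its hypercube representation $n=\sum_{\ell=0}^{i}\binom{k}{\ell}+m$ with $0\le m<\binom{k}{i+1}$. Let $\phi_k(n)$ be the maximum, over all sets $S$ of $n$ vertices of the hypercube $Q_k$, of the number of vertices of $S$ whose degree in the induced subgraph $Q_k[S]$ equals $k$. Then \[ \phi_k(n)=\sum_{\ell=0}^{i-1}\binom{k}{\ell}+m^{(k-i-1)}. \]
   Context: $Q_k$ is the graph with vertex set $\{0,1\}^k$ in which two vertices are adjacent iff they differ in exactly one coordinate; a vertex of an induced subgraph $Q_k[S]$ is called full if its degree in $Q_k[S]$ is $k$. Every integer $1\le n\le 2^k-1$ can be written uniquely as $n=\sum_{\ell=0}^{i}\binom{k}{\ell}+m$ with $0\le i\le k-1$ and $0\le m<\binom{k}{i+1}$ (hypercube representation). Upper boundary function: for $m,j\in\mathbb{N}=\{1,2,\dots\}$ there is a unique representation $m=\binom{a_j}{j}+\binom{a_{j-1}}{j-1}+\cdots+\binom{a_t}{t}$ with $a_j>a_{j-1}>\cdots>a_t\ge t\ge 1$, and one defines $m^{(j)}=\binom{a_j}{j+1}+\binom{a_{j-1}}{j}+\cdots+\binom{a_t}{t+1}$. By convention $0^{(j)}=0$ for every integer $j\ge 0$ (the case $m=0$ is the only one occurring when the exponent $k-i-1$ equals $0$). *)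

(* Defs.v *)
From mathcomp Require Import all_boot zify.

Set Implicit Arguments.
Unset Strict Implicit.
Unset Printing Implicit Defensive.

Definition cube (k : nat) : finType := {ffun 'I_k -> bool}.

Definition cube_adj (k : nat) (x y : cube k) : bool :=
  #|[set c : 'I_k | x c != y c]| == 1.

Definition induced_degree (k : nat) (S : {set cube k}) (v : cube k) : nat :=
  #|[set w in S | cube_adj v w]|.

Definition full_vertices (k : nat) (S : {set cube k}) : {set cube k} :=
  [set v in S | induced_degree S v == k].

(* For n <= 2 ^ k the maximum ranges over a nonempty family of sets. *)
Definition phi (k n : nat) : nat :=
  \max_(S : {set cube k} | #|S| == n) #|full_vertices S|.

(* The representation m = 'C(a_j, j) + ... + 'C(a_t, t) with
   a_j > ... > a_t >= t >= 1.  The coefficient a_l is nth 0 a l, for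
   t <= l <= j; the entries of a outside this range are irrelevant. *)
Definition cascade (m j t : nat) (a : seq nat) : bool :=
  [&& 1 <= t <= j,
      t <= nth 0 a t,
      all (fun l => nth 0 a l < nth 0 a l.+1) (index_iota t j)
    & m == \sum_(t <= l < j.+1) 'C(nth 0 a l, l)].

Definition cascade_upper (j t : nat) (a : seq nat) : nat :=
  \sum_(t <= l < j.+1) 'C(nth 0 a l, l.+1).

Lemma cascade_exists (m j : nat) : 0 < m -> 0 < j ->
  exists ta : nat * seq nat, cascade m j ta.1 ta.2.
Proof.
move=> m0 j0.
suff [t [a [/andP[t1 tj] Ht Ha Hm]]] : exists t, exists a : nat -> nat,
    [/\ 0 < t <= j, t <= a t, forall l, t <= l < j -> a l < a l.+1
      & m = \sum_(t <= l < j.+1) 'C(a l, l)].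
  exists (t, mkseq a j.+1); apply/and4P; split; rewrite /fst /snd.
  - by rewrite t1.
  - by rewrite nth_mkseq.
  - apply/allP=> l; rewrite mem_index_iota => /andP[tl lj].
    by rewrite !nth_mkseq ?Ha ?tl ?ltnS // ltnW.
  - rewrite {1}Hm; apply/eqP; apply: eq_big_nat => l /andP[_ lj].
    by rewrite nth_mkseq.
elim: j m m0 j0 => // j IHj m m0 _.
have ex_x : exists x, 'C(x, j.+1) <= m by exists 0; rewrite bin0n.
have bin_grow x : x - j <= 'C(x, j.+1).
  elim: x => [|x IHx]; first by rewrite bin0n.
  rewrite binS; case: (leqP j x) => jx; last by lia.
  by have := bin_gt0 x j; rewrite jx; lia.
have ub x : 'C(x, j.+1) <= m -> x <= m + j by have := bin_grow x; lia.
case: (ex_maxnP ex_x ub) => x xm xmax.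
have xlt : m < 'C(x.+1, j.+1).
  by rewrite ltnNge; apply/negP => /xmax; rewrite ltnn.
have jx : j.+1 <= x by apply: xmax; rewrite binn.
case: (posnP (m - 'C(x, j.+1))) => [r0|r0].
  exists j.+1, (fun=> x); split=> //; first by rewrite leqnn.
  - by move=> l; lia.
  - by rewrite big_nat1; lia.
have j0 : 0 < j.
  by case: j {IHj ex_x bin_grow ub jx xmax} xm xlt r0 => // ; rewrite !bin1; lia.
have [t [a [/andP[t1 tj] Ht Ha Hm]]] := IHj _ r0 j0.
exists t, (fun l => if l == j.+1 then x else a l); split.
- by rewrite t1; lia.
- by rewrite ifN //; lia.
- move=> l /andP[tl lj]; rewrite ifN; last by lia.
  rewrite eqSS; case: eqVneq => [->|ne]; last by apply: Ha; lia.
  rewrite ltnNge; apply/negP => xa.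
  have := leq_bin2l j xa.
  have : 'C(a j, j) <= m - 'C(x, j.+1) by rewrite Hm big_nat_recr //= leq_addl.
  by move: xlt; rewrite binS; lia.
- rewrite big_nat_recr /= ?eqxx; last by lia.
  rewrite (eq_big_nat _ _ (F2 := fun l => 'C(a l, l))) -?Hm; first by lia.
  by move=> l /andP[_ lj]; rewrite ifN //; lia.
Qed.

(* m^(j), read off the representation of m; the representation is unique and the
   value does not depend on the chosen witness (cascade_unique, upper_boundaryE).
   The value is 0 when m = 0, and, as a junk value, when m > 0 = j. *)
Definition upper_boundary (m j : nat) : nat :=
  match @idP (0 < m), @idP (0 < j) with
  | ReflectT m_gt0, ReflectT j_gt0 =>
      let: (t, a) := xchoose (cascade_exists m_gt0 j_gt0) in cascade_upper j t a
  | _, _ => 0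
  end.

Lemma cascade_lead (m j t : nat) (a : seq nat) : cascade m j t a ->
  'C(nth 0 a j, j) <= m < 'C((nth 0 a j).+1, j).
Proof.
case/and4P=> /andP[t1 tj] Ht /allP Ha /eqP->; apply/andP; split.
  by rewrite big_nat_recr //= leq_addl.
elim: j tj Ha => [|j IHj] tj Ha; first by lia.
have [tj'|jt] := leqP t j; last first.
  have -> : j.+1 = t by lia.
  rewrite big_nat1; case: t t1 Ht {tj Ha IHj jt} => // t _ Ht.
  by rewrite binS -addn1 leq_add2l bin_gt0; lia.
rewrite big_nat_recr //= binS addnC ltn_add2l.
apply: leq_trans (IHj tj' _) _.
  by move=> l; rewrite mem_index_iota => H; apply: Ha; rewrite mem_index_iota; lia.
by apply: leq_bin2l; apply: Ha; rewrite mem_index_iota; lia.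
Qed.

Lemma cascade_unique (m j t t' : nat) (a a' : seq nat) :
  cascade m j t a -> cascade m j t' a' ->
  t = t' /\ forall l, t <= l <= j -> nth 0 a l = nth 0 a' l.
Proof.
elim: j m => [|j IHj] m Hc Hc'; first by case/and4P: Hc; lia.
have Ex : nth 0 a j.+1 = nth 0 a' j.+1.
  have /andP[h1 h2] := cascade_lead Hc; have /andP[h1' h2'] := cascade_lead Hc'.
  case: (ltngtP (nth 0 a j.+1) (nth 0 a' j.+1)) => // lt.
    by have := leq_bin2l j.+1 lt; lia.
  by have := leq_bin2l j.+1 lt; lia.
have down s b : cascade m j.+1 s b ->
    (s = j.+1 /\ m = 'C(nth 0 b j.+1, j.+1)) \/
    (s <= j /\ 0 < m - 'C(nth 0 b j.+1, j.+1) /\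
     cascade (m - 'C(nth 0 b j.+1, j.+1)) j s b).
  case/and4P=> /andP[s1 sj] Hs /allP Hb /eqP Hm.
  have [sj'|js] := leqP s j; last first.
    have Es : s = j.+1 by lia.
    by left; split; rewrite // Hm Es big_nat1.
  have E : m - 'C(nth 0 b j.+1, j.+1) = \sum_(s <= l < j.+1) 'C(nth 0 b l, l).
    by rewrite Hm big_nat_recr //= addnK.
  right; rewrite E; split=> //; split.
    by rewrite (big_ltn (n := j.+1)) ?ltnS // addn_gt0 bin_gt0 Hs.
  apply/and4P; split=> //; first by rewrite s1.
  apply/allP=> l; rewrite mem_index_iota => H; apply: Hb.
  by rewrite mem_index_iota; lia.
have [[Et Em]|[tj [r0 Hr]]] := down _ _ Hc; have [[Et' Em']|[tj' [r0' Hr']]] := down _ _ Hc'.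
- by split=> [|l Hl]; [lia | have -> : l = j.+1 by lia].
- by rewrite -Ex in r0'; lia.
- by rewrite Ex in r0; lia.
- rewrite -Ex in Hr'; have [-> E] := IHj _ Hr Hr'; split=> // l Hl.
  by case: (eqVneq l j.+1) => [->//|ne]; apply: E; have := IHj _ Hr Hr'; lia.
Qed.

Lemma upper_boundaryE (m j t : nat) (a : seq nat) :
  cascade m j t a -> upper_boundary m j = cascade_upper j t a.
Proof.
move=> Hc; case/and4P: (Hc) => /andP[t1 tj] Ht _ /eqP Hm.
have m0 : 0 < m by rewrite Hm (big_ltn (n := j.+1)) ?ltnS // addn_gt0 bin_gt0 Ht.
have j0 : 0 < j by lia.
rewrite /upper_boundary; case: {-}_ / idP => // m0'; case: {-}_ / idP => // j0'.
case E : (xchoose _) => [t' a'].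
have := xchooseP (cascade_exists m0' j0'); rewrite E /= => Hc'.
have [Et Ea] := cascade_unique Hc Hc'; rewrite /cascade_upper -Et.
by apply: eq_big_nat => l Hl; rewrite Ea.
Qed.

Lemma upper_boundary0 (j : nat) : upper_boundary 0 j = 0.
Proof. by rewrite /upper_boundary; case: {-}_ / idP. Qed.

(* Main.v *)
(* Splitting a vertex set S of the (k+1)-cube along one coordinate into S0 and
   S1, the full vertices of S are those of S0 lying in S1 and those of S1 lying
   in S0.  If harper k bounds the number of full vertices in dimension k and
   #|S1| <= #|S0|, then S has at most
     minn (harper k #|S0|) #|S1| + harper k #|S1|
   full vertices, so the upper bound reduces to the numerical inequality
   minn_harper_le.  When #|S0| and #|S1| end in the same layer of the cube this
   is an inequality about a single function m |-> m^(j); when they end in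
   adjacent layers it is the numerical form of the Kruskal-Katona theorem; any
   larger gap follows by monotonicity.  The inequalities for m^(j) are proved
   by induction on j and on the size of the ground set.  Equality is attained
   by gluing a ball to a recursively built extremal set. *)
Require Import Defs.
From mathcomp Require Import all_boot zify.

Set Implicit Arguments.
Unset Strict Implicit.
Unset Printing Implicit Defensive.

(** * Counting completed sets by recursion on the ground set *)

(* For p <= 'C(a, j), kk a j p is the largest number of (j+1)-subsets of an
   a-set all of whose j-subsets lie in a family of p sets.  For j > 0 it does
   not depend on a (kk_widen); for j = 0 it does, kk a 0 1 = a standing for the
   a singletons whose only 0-subset is empty. *)
Fixpoint kk (a j p : nat) {struct a} : nat :=
  match a, j with
  | 0, _ => 0
  | a'.+1, 0 => if p is 0 then 0 else a
  | a'.+1, j'.+1 =>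
      if p <= 'C(a', j) then kk a' j p else 'C(a', j.+1) + kk a' j' (p - 'C(a', j))
  end.

Lemma kkn0 a j : kk a j 0 = 0.
Proof. by elim: a j => [|a IHa] [|j] //=. Qed.

Lemma kk_bin a j : kk a j 'C(a, j) = 'C(a, j.+1).
Proof.
elim: a j => [|a IHa] [|j] //=; first by rewrite bin1.
rewrite binS; case: leqP => h; last by rewrite addKn IHa -binS.
have j0 : 'C(a, j) = 0 by lia.
rewrite j0 addn0 IHa binS (@bin_small a j.+1) ?addn0 //.
by move/eqP: j0; rewrite -leqn0 leqNgt bin_gt0 -ltnNge; lia.
Qed.

Lemma kkS_le a j p : p <= 'C(a, j.+1) -> kk a.+1 j.+1 p = kk a j.+1 p.
Proof. by move=> /= ->. Qed.

Lemma kkS_add a j r :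
  kk a.+1 j.+1 ('C(a, j.+1) + r) = 'C(a, j.+2) + kk a j r.
Proof.
rewrite /=; case: leqP => h; last by rewrite addKn.
have -> : r = 0 by lia.
by rewrite addn0 kk_bin kkn0 addn0.
Qed.

Lemma leq_kk a j p q : p <= q -> kk a j p <= kk a j q.
Proof.
elim: a j p q => [|a IHa] [|j] p q //=.
  by case: p => // p; case: q.
move=> pq; case: (leqP p _) => hp; case: (leqP q _) => hq //; try lia.
- exact: IHa.
- by apply: (@leq_trans 'C(a, j.+2)); rewrite ?leq_addr // -kk_bin IHa.
- by rewrite leq_add2l IHa //; lia.
Qed.

Lemma kk_widen a A j p : a <= A -> p <= 'C(a, j.+1) -> kk A j.+1 p = kk a j.+1 p.
Proof.
move=> /subnK <- hp; elim: (A - a) => // d IHd.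
by rewrite addSn kkS_le // (leq_trans hp) // leq_bin2l // leq_addl.
Qed.

Lemma kk_widen_le a A j p : a <= A -> p <= 'C(a, j) -> kk a j p <= kk A j p.
Proof.
case: j => [|j] aA hp; last by rewrite -(kk_widen aA hp).
by case: p hp => [|p] _; [rewrite !kkn0 | case: a aA => //; case: A].
Qed.

Lemma kk_le_bin a j p : p <= 'C(a, j) -> kk a j p <= 'C(a, j.+1).
Proof. by move=> /(leq_kk a j); rewrite kk_bin. Qed.

(** * Superadditivity and its dual *)

Definition superadditive (j : nat) := forall a p q,
  p + q <= 'C(a, j) -> kk a j p + kk a j q <= kk a j (p + q).

(* The last 'C(a, j) - q sets of the a-set complete at least as many (j+1)-sets
   as any other window of that length. *)
Definition top_heavy (j : nat) := forall a p q g,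
  p <= 'C(a, j) -> q <= 'C(a, j) -> p + q = 'C(a, j) + g ->
  kk a j p + kk a j q <= 'C(a, j.+1) + kk a j g.

(** The recursion splits [p] into ['C(a, j.+1)] and a remainder already counted at level [j];
    induction on [a] lowers the first part and superadditivity merges the two. *)
Lemma kk_le_pred j : superadditive j ->
  forall a A p, p <= 'C(a, j.+1) -> p <= 'C(A, j) -> kk a j.+1 p <= kk A j p.
Proof.
move=> Sj; elim=> [|a IHa] A p // ; rewrite binS => pa pA.
case: (leqP p 'C(a, j.+1)) => h; first by rewrite kkS_le // IHa.
have [r Er] : exists r, p = 'C(a, j.+1) + r by exists (p - 'C(a, j.+1)); lia.
rewrite Er kkS_add; apply: leq_trans (Sj _ _ _ _); last by rewrite -Er.
rewrite -kk_bin leq_add ?IHa //; [by lia|].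
have [aA|Aa] := leqP a A; first by rewrite kk_widen_le //; lia.
case: j {Sj IHa} pa pA h Er => [|j] pa pA h Er.
  rewrite ?bin0 ?bin1 in pa pA h Er; lia.
by rewrite (@kk_widen A) //; lia.
Qed.

(* Removing the last q sets from all j-subsets of an A-set costs at least as much
   as removing the last q from all (j+1)-subsets of an a-set. *)
Lemma kk_top_le_pred j : superadditive j -> top_heavy j ->
  forall a A q p r, a <= A -> p + q = 'C(a, j.+1) -> r + q = 'C(A, j) ->
  'C(a, j.+2) + kk A j r <= 'C(A, j.+1) + kk a j.+1 p.
Proof.
move=> Sj Ej; elim=> [|a IHa] A q p r aA hp hr.
  by rewrite bin0n /= -kk_bin addn0 leq_kk //; lia.
rewrite binS in hp.
case: (leqP p 'C(a, j.+1)) => h; last first.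
  have [s Es] : exists s, p = 'C(a, j.+1) + s by exists (p - 'C(a, j.+1)); lia.
  rewrite Es kkS_add binS.
  have := Ej A 'C(a, j) r s.
  have aA' : 'C(a, j) <= 'C(A, j) by apply: leq_bin2l; lia.
  have := @kk_widen_le a A j s; have := @kk_widen_le a A j 'C(a, j).
  rewrite kk_bin.
  case: j {Sj Ej IHa} hp hr h Es aA' => [|j] hp hr h Es aA'; last first.
    rewrite (@kk_widen a A) ?kk_bin //; try lia.
    rewrite (@kk_widen a A) //; lia.
  rewrite ?bin0 ?bin1 in hp hr h Es aA' *.
  have := kk_bin A 0; have := kk_bin a 0; rewrite !bin0 !bin1.
  have [-> ->] : r = 1 /\ s = 1 by lia.
  by lia.
rewrite kkS_le // binS.
(* [q] covers all ['C(a, j)] sets through the new point and [s] others: induction handles [s],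
   superadditivity the rest. *)
have [s Es] : exists s, q = 'C(a, j) + s by exists (q - 'C(a, j)); lia.
have := IHa A s p (r + 'C(a, j)).
have := Sj A r 'C(a, j).
case: j {Sj Ej IHa} hp hr h Es => [|j] hp hr h Es.
  have := kk_bin a 1; rewrite ?bin0 ?bin1 in hp hr h Es *.
  by have [-> ->] : p = a /\ r = 0 by [lia]; rewrite kkn0; lia.
rewrite [kk A _ 'C(_, _)](@kk_widen a A) ?kk_bin //; lia.
Qed.

(** Joint induction on [j], then on [a]: superadditivity for [a.+1] needs top-heaviness for [a] when
    a sum crosses ['C(a, j.+1)], and [Q] and [T] compare level [j.+1] with level [j]. *)
Lemma superadditive_top_heavy j : superadditive j /\ top_heavy j.
Proof.
elim: j => [|j [Sj Ej]].
  split=> a p q.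
    by case: p => [|[|p]]; case: q => [|q]; rewrite ?add0n ?addn0 ?kkn0 ?bin0 ?addn0; lia.
  move=> g; have := kk_bin a 0; rewrite !bin0.
  case: p => [|[|p]]; case: q => [|[|q]]; case: g => [|g]; rewrite ?kkn0; try lia.
  by case: g => [|g]; lia.
have Q := kk_le_pred Sj; have T := kk_top_le_pred Sj Ej.
suff /all_and2[H1 H2] : forall a,
    (forall p q, q <= p -> p + q <= 'C(a, j.+1) ->
       kk a j.+1 p + kk a j.+1 q <= kk a j.+1 (p + q)) /\
    (forall p q g, q <= p -> p <= 'C(a, j.+1) -> p + q = 'C(a, j.+1) + g ->
       kk a j.+1 p + kk a j.+1 q <= 'C(a, j.+2) + kk a j.+1 g).
  split=> a p q; first case: (leqP q p) => h.
  - exact: H1.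
  - by rewrite [kk _ _ p + _]addnC [p + q]addnC; apply: H1; lia.
  - move=> g hp hq e; case: (leqP q p) => h; first exact: H2 h hp e.
    by rewrite [kk _ _ p + _]addnC; apply: H2; lia.
elim=> [|a [IHS IHE]]; first by [].
have split_ge p : 'C(a, j.+1) < p -> exists r, p = 'C(a, j.+1) + r.
  by exists (p - 'C(a, j.+1)); lia.
split=> p q => [|g]; rewrite !binS; move=> qp hp.
  case: (leqP p 'C(a, j.+1)) => hpc.
    rewrite ![kk _ _ p]kkS_le ?[kk _ _ q]kkS_le //; last by lia.
    case: (leqP (p + q) 'C(a, j.+1)) => hpq; first by rewrite kkS_le // IHS.
    have [r Er] := split_ge _ hpq.
    rewrite Er kkS_add; apply: leq_trans (IHE p q r qp hpc Er) _.
    by rewrite leq_add2l Q //; lia.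
  have [r Er] := split_ge _ hpc; rewrite Er -addnA !kkS_add -addnA leq_add2l.
  case: (leqP q 'C(a, j.+1)) => hqc.
    rewrite kkS_le //; apply: leq_trans (Sj _ _ _ _); last by lia.
    by rewrite leq_add2l Q //; lia.
  have [s Es] := split_ge _ hqc; rewrite Es kkS_add.
  have := Sj a r ('C(a, j.+1) + s); have := Sj a 'C(a, j.+1) s.
  by have := Q a a 'C(a, j.+1); rewrite kk_bin; lia.
move=> e; case: (leqP p 'C(a, j.+1)) => hpc.
  rewrite !kkS_le //; try lia.
  (* [IHE] is applied to [p] and [q], then again to trim the excess ['C(a, j) + g] down to [g]; [T]
     bounds the cost of the trim by ['C(a, j.+1)]. *)
  have := T a a 'C(a, j) ('C(a, j.+1) - 'C(a, j)) 0; rewrite kkn0.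
  have := IHE p q ('C(a, j) + g) qp hpc.
  case: (leqP g ('C(a, j.+1) - 'C(a, j))) => hg.
    have := IHE ('C(a, j.+1) - 'C(a, j)) ('C(a, j) + g) g.
    have := IHE ('C(a, j) + g) ('C(a, j.+1) - 'C(a, j)) g.
    lia.
  have := IHE ('C(a, j) + g) ('C(a, j.+1) - 'C(a, j)) g.
  lia.
have [r Er] := split_ge _ hpc; rewrite Er kkS_add.
case: (leqP q 'C(a, j.+1)) => hqc.
  rewrite !kkS_le //; try lia.
  have := T a a ('C(a, j) - r) ('C(a, j.+1) - ('C(a, j) - r)) r.
  have := IHE q ('C(a, j.+1) - ('C(a, j) - r)) g.
  have := IHE ('C(a, j.+1) - ('C(a, j) - r)) q g.
  lia.
have [s Es] := split_ge _ hqc; rewrite Es kkS_add.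
case: (leqP 'C(a, j) (r + s)) => h.
  have -> : g = 'C(a, j.+1) + (r + s - 'C(a, j)) by lia.
  by rewrite kkS_add; have := Ej a r s (r + s - 'C(a, j)); lia.
rewrite kkS_le; last by lia.
have := T a a ('C(a, j) - (r + s)) g (r + s).
have := Sj a r s.
lia.
Qed.

Lemma kk_superadd j : superadditive j.
Proof. by case: (superadditive_top_heavy j). Qed.

Lemma kk_top_heavy j : top_heavy j.
Proof. by case: (superadditive_top_heavy j). Qed.

(** * The numerical Kruskal-Katona inequality *)

Lemma kk1 a p : p <= a -> kk a 1 p = 'C(p, 2).
Proof.
move=> pa; rewrite (@kk_widen p a) ?bin1 //.
by have := kk_bin p 1; rewrite bin1.
Qed.

(* Kruskal-Katona: d counts the (j+1)-sets containing a fixed point of the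
   (a+1)-set, e those avoiding it. *)
Lemma minn_kk_le a j d e : d <= 'C(a, j) -> e <= 'C(a, j.+1) ->
  minn (kk a j d) e + kk a j.+1 e <= kk a.+1 j.+1 (d + e).
Proof.
elim: a j d e => [|a IHa] j d e; first by rewrite bin0n /=; lia.
case: j => [|j] hd he.
  rewrite bin0 bin1 in hd he; rewrite !kk1; try lia.
  case: d hd => [|[|//]] _; first by rewrite kkn0 min0n.
  by rewrite add1n binS bin1; lia.
rewrite !binS in hd he.
have Sj := @kk_superadd j.+1; have Ej := @kk_top_heavy j.+1.
have small d' e' : d' <= 'C(a, j.+1) -> e' <= 'C(a, j.+2) ->
    minn (kk a j.+1 d') e' + kk a j.+2 e' <= kk a.+2 j.+2 (d' + e').
  move=> h1 h2; rewrite kkS_le; last by rewrite binS; lia.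
  exact: IHa.
case: (leqP d 'C(a, j.+1)) => hdc.
  rewrite (kkS_le hdc); case: (leqP e 'C(a, j.+2)) => hec.
    by rewrite kkS_le //; apply: small.
  have [s Es] : exists s, e = 'C(a, j.+2) + s by exists (e - 'C(a, j.+2)); lia.
  rewrite {2}Es kkS_add.
  (* [kk a j.+1 d <= 'C(a, j.+2) < e], so the minimum is its first argument. *)
  have ub := kk_le_bin hdc.
  case: (leqP (d + s) 'C(a, j.+1)) => hds.
    have -> : d + e = 'C(a, j.+2) + (d + s) by lia.
    rewrite kkS_le ?kkS_add; last by rewrite binS; lia.
    by have := Sj a d s; lia.
  have [g Eg] : exists g, d + s = 'C(a, j.+1) + g by exists (d + s - 'C(a, j.+1)); lia.
  have -> : d + e = 'C(a.+1, j.+2) + g by rewrite binS; lia.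
  rewrite kkS_add binS kkS_le; last by lia.
  by have := Ej a d s g; lia.
have [r Er] : exists r, d = 'C(a, j.+1) + r by exists (d - 'C(a, j.+1)); lia.
rewrite Er kkS_add; case: (leqP e 'C(a, j.+2)) => hec.
  have := small 'C(a, j.+1) e (leqnn _) hec.
  rewrite kk_bin (kkS_le hec).
  have := @leq_kk a.+2 j.+2 ('C(a, j.+1) + e) ('C(a, j.+1) + r + e).
  lia.
have [s Es] : exists s, e = 'C(a, j.+2) + s by exists (e - 'C(a, j.+2)); lia.
rewrite Es kkS_add.
have -> : 'C(a, j.+1) + r + ('C(a, j.+2) + s) = 'C(a.+1, j.+2) + (r + s).
  by rewrite binS; lia.
rewrite kkS_add binS; have := IHa j r s.
lia.
Qed.

Arguments kk : simpl never.

(** * Values of [kk] and the upper boundary function *)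

Lemma kk_diag k p : p <= 1 -> kk k k p = 0.
Proof.
move=> p1; apply/eqP; rewrite -leqn0 -[0](@bin_small k k.+1) //.
by apply: kk_le_bin; rewrite binn.
Qed.

(** Once the ground set is cut down to one more point than the leading coefficient, one step of [kk]
    splits off the leading term; [cascade_lead] bounds the tail. *)
Lemma kk_cascade k m j t a :
  cascade m j t a -> nth 0 a j < k -> kk k j m = cascade_upper j t a.
Proof.
elim: j k m => [|j IHj] k m Hc hk; first by case/and4P: Hc; lia.
case/and4P: (Hc) => /andP[t1 tj] Ht /allP Ha /eqP Hm.
set x := nth 0 a j.+1 in hk.
have [jt|tj'] := ltnP j t.
  have Et : t = j.+1 by lia.
  rewrite Hm /cascade_upper Et !big_nat1 -/x (@kk_widen x) ?kk_bin //; lia.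
have Hc' : cascade (\sum_(t <= l < j.+1) 'C(nth 0 a l, l)) j t a.
  apply/and4P; split=> //; first by rewrite t1.
  apply/allP=> l; rewrite mem_index_iota => H; apply: Ha.
  by rewrite mem_index_iota; lia.
have ax : nth 0 a j < x by apply: Ha; rewrite mem_index_iota; lia.
have /andP[_ lt_m'] := cascade_lead Hc'.
have := leq_trans lt_m' (leq_bin2l _ ax).
have := IHj _ _ Hc' ax.
rewrite Hm /cascade_upper !(@big_nat_recr _ _ _ j.+1) //= -/x.
set m' := \sum_(t <= l < j.+1) 'C(_, l) => <- hm'.
rewrite (@kk_widen x.+1) ?binS; [|lia..].
by rewrite addnC kkS_add addnC.
Qed.

(** Strictness excludes [j = 0], [m = 1], where [kk] is [k] but [upper_boundary] is 0, and keeps the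
    leading coefficient below [k]. *)
Lemma kk_upper_boundary k j m : m < 'C(k, j) -> kk k j m = upper_boundary m j.
Proof.
case: (posnP m) => [->|m0 hm]; first by rewrite kkn0 upper_boundary0.
have j0 : 0 < j by case: j hm => //; rewrite bin0; lia.
have [[t a] /= Hc] := cascade_exists m0 j0.
rewrite (upper_boundaryE Hc) (kk_cascade Hc) //.
have /andP[lead _] := cascade_lead Hc.
rewrite ltnNge; apply/negP => /(leq_bin2l j); lia.
Qed.

(** * Ball sizes and the numerical induction step *)

(* The number of vertices with fewer than i ones: a ball of radius i - 1. *)
Definition ball_card k i := \sum_(0 <= l < i) 'C(k, l).

Lemma ball_cardS k i : ball_card k i.+1 = ball_card k i + 'C(k, i).
Proof. by rewrite /ball_card big_nat_recr. Qed.

Lemma ball_card0 k : ball_card k 0 = 0.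
Proof. by rewrite /ball_card big_geq. Qed.

Lemma ball_cardSl k i : ball_card k.+1 i = ball_card k i + ball_card k i.-1.
Proof.
elim: i => [|[|i] IHi]; first by rewrite !ball_card0.
  by rewrite !ball_cardS !ball_card0 !bin0.
by rewrite ball_cardS IHi (ball_cardS k i.+1) /= (ball_cardS k i) binS; lia.
Qed.

Lemma ball_card_full k : ball_card k k.+1 = 2 ^ k.
Proof.
rewrite -addn1 -[2]/(1 + 1) expnDn /ball_card addn1 big_mkord.
by apply: eq_bigr => i _; rewrite !exp1n !muln1.
Qed.

Lemma leq_ball_card k i j : i <= j -> ball_card k i <= ball_card k j.
Proof.
move=> /subnK <-; elim: (j - i) => // d IHd.
by rewrite addSn ball_cardS; lia.
Qed.

Lemma ball_card_decomp k i n : n <= ball_card k i.+1 ->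
  exists s e, [/\ s <= i, e <= 'C(k, s) & n = ball_card k s + e].
Proof.
elim: i => [|i IHi] hn.
  by exists 0, n; rewrite ball_card0; split=> //; move: hn; rewrite ball_cardS ball_card0.
case: (leqP n (ball_card k i.+1)) => h.
  by have [s [e [? ? ?]]] := IHi h; exists s, e; split=> //; lia.
exists i.+1, (n - ball_card k i.+1); split=> //; last by lia.
by move: hn; rewrite ball_cardS; lia.
Qed.

(* For n = ball_card k i + m with m <= 'C(k, i) this is
   ball_card k i.-1 + kk k (k - i) m (harperE); the case i = k, m = 1 gives
   harper k (2 ^ k) = 2 ^ k - 1, one less than the number of full vertices. *)
Definition harper k n :=
  \sum_(0 <= i < k.+1) kk k (k - i) (minn (n - ball_card k i) 'C(k, i)).

Lemma leq_harper k n n' : n <= n' -> harper k n <= harper k n'.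
Proof. by move=> h; apply: leq_sum => i _; apply: leq_kk; lia. Qed.

Lemma bin_subS k i : i < k -> 'C(k, (k - i.+1).+1) = 'C(k, i).
Proof. by move=> ik; rewrite -[RHS]bin_sub ?subnSK // ltnW. Qed.

Lemma ball_card_pred k i : i <= k ->
  ball_card k i.-1 + 'C(k, (k - i).+1) = ball_card k i.
Proof.
case: i => [|i] ik /=; first by rewrite subn0 bin_small ?addn0.
by rewrite bin_subS // ball_cardS.
Qed.

(** A full layer [l < i] contributes ['C(k, (k - l).+1)], which is ['C(k, l.-1)] for [l > 0] and 0
    for [l = 0]; these add up to the smaller ball. *)
Lemma harperE k i m : i <= k -> m <= 'C(k, i) ->
  harper k (ball_card k i + m) = ball_card k i.-1 + kk k (k - i) m.
Proof.
move=> ik hm; rewrite /harper (big_cat_nat (n := i)) //=; last by lia.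
rewrite (big_ltn (m := i)) ?ltnS //=.
rewrite addKn (minn_idPl hm) [X in _ + (_ + X)]big1_seq ?addn0; last first.
  move=> l; rewrite mem_index_iota => /andP[_ /andP[il lk]].
  have := leq_ball_card k il; rewrite ball_cardS => h.
  by rewrite (_ : minn _ _ = 0) ?kkn0 //; lia.
congr (_ + _); rewrite -/(ball_card k i.-1).
have -> : \sum_(0 <= l < i) kk k (k - l) (minn (ball_card k i + m - ball_card k l) 'C(k, l))
  = \sum_(0 <= l < i) 'C(k, (k - l).+1).
  apply: eq_big_nat => l /andP[_ li].
  have := leq_ball_card k li; rewrite ball_cardS => h.
  by rewrite (_ : minn _ _ = 'C(k, k - l)) ?kk_bin // bin_sub; lia.
elim: i ik {hm} => [|i IHi] ik; first by rewrite ball_card0 big_geq.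
by rewrite big_nat_recr //= IHi ?ball_card_pred // ltnW.
Qed.

(** Layer [s.+1] of one half and layer [s] of the other form layer [s.+1] of the (k+1)-cube;
    cancelling the balls leaves [minn_kk_le]. *)
Lemma harper_adjacent k s e d : s < k -> e <= 'C(k, s) -> d <= 'C(k, s.+1) ->
  minn (harper k (ball_card k s.+1 + d)) (ball_card k s + e) +
    harper k (ball_card k s + e) <=
  harper k.+1 (ball_card k s.+1 + d + (ball_card k s + e)).
Proof.
move=> sk he hd; have sk' := ltnW sk; rewrite !harperE //.
have -> : ball_card k s.+1 + d + (ball_card k s + e) =
   ball_card k.+1 s.+1 + (d + e) by rewrite ball_cardSl /=; lia.
rewrite harperE ?binS //=; [|lia..].
rewrite ball_cardSl subSS.
have := @minn_kk_le k (k - s.+1) d e.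
by rewrite (subnSK sk) !bin_sub //; lia.
Qed.

(** If [d + e] fills a layer, the total ends in layer [s.+1] of the (k+1)-cube and [kk_top_heavy]
    applies; otherwise it ends in layer [s] and [kk_superadd] applies. *)
Lemma harper_same k s e d : s <= k -> e <= 'C(k, s) -> d <= 'C(k, s) ->
  harper k (ball_card k s + d) + harper k (ball_card k s + e) <=
  harper k.+1 (ball_card k s + d + (ball_card k s + e)).
Proof.
move=> sk he hd; rewrite !harperE //.
have sC := bin_sub sk.
case: (leqP 'C(k, s) (d + e)) => hde.
  have -> : ball_card k s + d + (ball_card k s + e) =
      ball_card k.+1 s.+1 + (d + e - 'C(k, s)).
    by rewrite ball_cardSl /= ball_cardS; lia.
  rewrite harperE ?binS //=; [|lia..].
  rewrite ball_cardSl subSS.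
  have := @kk_top_heavy (k - s) k d e (d + e - 'C(k, s)).
  have := @kk_widen_le k k.+1 (k - s) (d + e - 'C(k, s)) (leqnSn _).
  have := ball_card_pred sk.
  by rewrite sC; lia.
case: s sk he hd sC hde => [|s] sk he hd sC hde.
  by rewrite !bin0 in he hd hde; rewrite ball_card0 subn0 !kk_diag; lia.
have := ball_cardS k s => Es; have := ball_cardSl k s.+1 => /= Es'.
have -> : ball_card k s.+1 + d + (ball_card k s.+1 + e) =
      ball_card k.+1 s.+1 + ('C(k, s) + (d + e)) by lia.
rewrite harperE /= ?binS; [|lia..].
have := @kk_superadd (k - s.+1) k d e.
rewrite sC subSS -(subnSK sk) -(bin_subS sk) kkS_add ball_cardSl.
have := ball_card_pred (ltnW sk); rewrite -(subnSK sk); lia.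
Qed.

Lemma minn_harper_le k x y : y <= x -> x <= 2 ^ k ->
  minn (harper k x) y + harper k y <= harper k.+1 (x + y).
Proof.
rewrite -ball_card_full => yx /ball_card_decomp[t [d [tk hd Ex]]].
have /ball_card_decomp[s [e [st he Ey]]] : y <= ball_card k t.+1.
  by rewrite ball_cardS; lia.
have [Est|ts] := eqVneq s t.
  rewrite {}Est in he Ey; rewrite Ex Ey.
  by apply: leq_trans (harper_same tk he hd); rewrite leq_add2r geq_minl.
have sk : s < k by lia.
have [Est|ts'] := eqVneq s.+1 t.
  by rewrite -{}Est in hd Ex; rewrite Ex Ey; apply: harper_adjacent.
(* [x] is lowered to [ball_card k s.+2], whose [harper] value [ball_card k s.+1] is at least [y], so
   the minimum is [y]. *)
have := harper_adjacent sk he (leqnn _); rewrite -ball_cardS -Ey.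
have := @harperE k s.+2 0; rewrite addn0 kkn0 addn0 => -> //; last by lia.
have hst : s.+2 <= t by lia.
have := leq_ball_card k hst.
have := @leq_harper k.+1 (ball_card k s.+2 + y) (x + y).
have := ball_cardS k s.
rewrite /=; lia.
Qed.

(** * Slices of the cube and the upper bound *)

Definition flip k (v : cube k) (c : 'I_k) : cube k :=
  [ffun c' => v c' (+) (c' == c)].

Lemma flip_inj k (v : cube k) : injective (flip v).
Proof.
by move=> c d /ffunP/(_ c); rewrite !ffunE eqxx => /addbI/esym/eqP.
Qed.

Lemma cube_adjE k (v w : cube k) : cube_adj v w = (w \in flip v @: setT).
Proof.
apply/cards1P/imsetP => [[c Ec]|[c _ ->]]; exists c => //.
  apply/ffunP => d; rewrite ffunE; move/setP/(_ d): Ec; rewrite !inE => <-.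
  by case: (v d); case: (w d).
by apply/setP => d; rewrite !inE ffunE; case: (v d); case: (d == c).
Qed.

Lemma full_verticesE k (S : {set cube k}) :
  full_vertices S = [set v in S | [forall c, flip v c \in S]].
Proof.
apply/setP => v; rewrite !inE; congr (_ && _); rewrite /induced_degree.
have -> : [set w in S | cube_adj v w] = flip v @: setT :&: S.
  by apply/setP => w; rewrite !inE cube_adjE andbC.
set N := flip v @: setT; have cardN : #|N| = k.
  by rewrite card_imset ?cardsT ?card_ord //; apply: flip_inj.
transitivity (#|N :&: S| == #|N|); first by rewrite cardN.
apply/idP/forallP => [/eqP e c|H].
  have /setIidPl/subsetP sub : N :&: S = N by apply/eqP; rewrite eqEcard subsetIl e leqnn.
  by apply: sub; apply: imset_f.
by have /setIidPl -> : N \subset S by apply/subsetP => w /imsetP[c _ ->].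
Qed.

Definition vcons k (b : bool) (x : cube k) : cube k.+1 :=
  [ffun c => oapp x b (unlift ord0 c)].

Definition vbehead k (v : cube k.+1) : cube k := [ffun c => v (lift ord0 c)].

Lemma vcons0 k b (x : cube k) : vcons b x ord0 = b.
Proof. by rewrite ffunE unlift_none. Qed.

Lemma vconsK k b : cancel (@vcons k b) (@vbehead k).
Proof. by move=> x; apply/ffunP => c; rewrite !ffunE liftK. Qed.

Lemma vcons_behead k (v : cube k.+1) : vcons (v ord0) (vbehead v) = v.
Proof. by apply/ffunP => c; rewrite ffunE; case: unliftP => [d|] -> //=; rewrite ffunE. Qed.

Lemma flip_vcons0 k b (x : cube k) : flip (vcons b x) ord0 = vcons (~~ b) x.
Proof.
apply/ffunP => c; rewrite !ffunE; case: unliftP => [d|] -> /=.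
  by rewrite eq_sym (negPf (neq_lift _ _)) addbF.
by rewrite eqxx addbT.
Qed.

Lemma flip_vcons_lift k b (x : cube k) c :
  flip (vcons b x) (lift ord0 c) = vcons b (flip x c).
Proof.
apply/ffunP => d; rewrite !ffunE; case: unliftP => [e|] -> /=.
  by rewrite ffunE (inj_eq lift_inj).
by rewrite (negPf (neq_lift _ _)) addbF.
Qed.

Definition slice k (S : {set cube k.+1}) (b : bool) : {set cube k} :=
  [set x | vcons b x \in S].

Lemma card_slices k (S : {set cube k.+1}) : #|S| = #|slice S false| + #|slice S true|.
Proof.
have slice_card b : #|slice S b| = #|[set v in S | v ord0 == b]|.
  rewrite -(card_imset _ (can_inj (@vconsK k b))); congr #|pred_of_set _|.
  apply/setP => v; rewrite inE; apply/imsetP/andP => [[x]|[vS /eqP <-]].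
    by rewrite inE => xS ->; rewrite vcons0.
  by exists (vbehead v); rewrite ?inE vcons_behead.
rewrite !slice_card -(cardsID [set v : cube k.+1 | v ord0] S) addnC.
by congr (_ + _); apply: eq_card => v; rewrite !inE; case: (v ord0); rewrite ?andbT ?andbF.
Qed.

Lemma slice_full k (S : {set cube k.+1}) b :
  slice (full_vertices S) b = full_vertices (slice S b) :&: slice S (~~ b).
Proof.
apply/setP => x; rewrite !full_verticesE !inE -andbA; congr (_ && _).
apply/forallP/andP => [H|[/forallP H Hb] c].
  split; last by rewrite -flip_vcons0.
  by apply/forallP => c; rewrite inE -flip_vcons_lift.
have [d|] := unliftP ord0 c => ->; last by rewrite flip_vcons0.
by rewrite flip_vcons_lift; have := H d; rewrite inE.
Qed.

Lemma card_full_le_harper k (S : {set cube k}) :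
  #|S| < 2 ^ k -> #|full_vertices S| <= harper k #|S|.
Proof.
elim: k S => [|k IHk] S hS.
  rewrite (@leq_trans #|S|) //; last by lia.
  by apply/subset_leq_card/subsetP => v; rewrite inE => /andP[].
rewrite (card_slices (full_vertices S)) !slice_full (card_slices S) /=.
rewrite card_slices in hS; move: hS.
move: (slice S false) (slice S true) => S0 S1.
wlog le10 : S0 S1 / #|S1| <= #|S0|.
  move=> W; case: (leqP #|S1| #|S0|) => h; first exact: W.
  by rewrite [#|S0| + _]addnC [#|_ :&: S1| + _]addnC; apply: W; apply: ltnW.
rewrite expnS => hS.
have max0 : #|S0| <= 2 ^ k.
  by rewrite (leq_trans (max_card _)) // card_ffun card_bool card_ord.
apply: leq_trans (minn_harper_le le10 max0).
apply: leq_add; last first.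
  by rewrite (leq_trans (subset_leq_card (subsetIl _ _))) // IHk //; lia.
have le1 := subset_leq_card (subsetIr (full_vertices S0) S1).
rewrite leq_min le1 andbT.
case: (ltnP #|S0| (2 ^ k)) => h0.
  by apply: leq_trans (IHk _ h0); apply: subset_leq_card (subsetIl _ _).
(* Induction does not cover the whole cube. There [harper] is [2 ^ k - 1], which still bounds
   [#|S1|] because the two slices are not both everything. *)
have -> : #|S0| = ball_card k k + 1 by have := ball_card_full k; rewrite ball_cardS binn; lia.
rewrite harperE ?binn // subnn.
have := kk_bin k 0; rewrite bin0 => ->.
have := @ball_card_pred k k (leqnn _); rewrite subnn => ->.
apply: leq_trans le1 _; have := ball_card_full k; rewrite ball_cardS binn; lia.
Qed.

(** * Balls and extremal sets *)

(* The vertices with fewer than i coordinates equal to true. *)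
Fixpoint ball k i : {set cube k} :=
  match k with
  | 0 => if i is 0 then set0 else setT
  | k'.+1 => [set v | vbehead v \in ball k' (if v ord0 then i.-1 else i)]
  end.

Definition join k (A0 A1 : {set cube k}) : {set cube k.+1} :=
  [set v | vbehead v \in if v ord0 then A1 else A0].

Lemma slice_join k (A0 A1 : {set cube k}) b :
  slice (join A0 A1) b = if b then A1 else A0.
Proof. by apply/setP => x; rewrite !inE vcons0 vconsK. Qed.

Lemma card_join k (A0 A1 : {set cube k}) : #|join A0 A1| = #|A0| + #|A1|.
Proof. by rewrite card_slices !slice_join. Qed.

Lemma subset_slices k (A B : {set cube k.+1}) :
  (forall b, slice A b \subset slice B b) -> A \subset B.
Proof.
move=> H; apply/subsetP => v vA.
by have /subsetP/(_ (vbehead v)) := H (v ord0); rewrite !inE vcons_behead; apply.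
Qed.

Lemma ballS k i : ball k.+1 i = join (ball k i) (ball k i.-1).
Proof. by apply/setP => v; rewrite !inE; case: (v ord0). Qed.

Lemma card_ball k i : #|ball k i| = ball_card k i.
Proof.
elim: k i => [|k IHk] i; last by rewrite ballS card_join !IHk ball_cardSl.
case: i => [|i] /=; first by rewrite cards0 ball_card0.
rewrite cardsT card_ffun card_ord /= expn0.
by elim: i => [|i IHi]; rewrite ball_cardS ?ball_card0 // -IHi.
Qed.

Lemma ball_sub_full k i : ball k i.-1 \subset full_vertices (ball k i).
Proof.
elim: k i => [|k IHk] i.
  rewrite full_verticesE; apply/subsetP => v hv; rewrite inE.
  apply/andP; split; last by apply/forallP => -[].
  by case: i hv => [|i] //= _; rewrite inE.
apply: subset_slices => b; rewrite slice_full !ballS !slice_join subsetI.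
case: b; rewrite /= IHk ?subxx //=.
have full_sub (j : nat) : ball k j.-1 \subset ball k j.
  by apply: subset_trans (IHk j) _; apply/subsetP => v; rewrite inE => /andP[].
exact: subset_trans (full_sub _) (full_sub _).
Qed.

Lemma ball_sub k i : ball k i.-1 \subset ball k i.
Proof.
apply: subset_trans (ball_sub_full k i) _.
by apply/subsetP => v; rewrite inE => /andP[].
Qed.

(** Keeping [I] inside the ball and the ball inside [A] is what makes gluing work: a full vertex of
    one half must have its copy in the other half. *)
Lemma exists_harper_set k i m : i <= k -> m <= 'C(k, i) ->
  exists A I : {set cube k},
    [/\ ball k i \subset A, I \subset ball k i, I \subset full_vertices A,
        #|A| = ball_card k i + m & #|I| = ball_card k i.-1 + kk k (k - i) m].
Proof.
elim: k i m => [|k IHk] [|i] m ik hm; try by [].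
1,2: rewrite bin0 in hm.
1,2: exists (if m is 0 then set0 else [set [ffun => false]]), set0.
1,2: have b0 k' : ball k' 0 = set0 by apply/cards0_eq; rewrite card_ball ball_card0.
1,2: rewrite b0 !sub0set cards0 !ball_card0 subn0 kk_diag //.
1,2: by split=> //; case: m hm => [|[]]; rewrite ?cards0 ?cards1.
have Bk := ball_card_pred ik.
have [Eik|ik'] := eqVneq i k.
  move: ik hm Bk; rewrite Eik binn subnn => _ hm Bk.
  case: m hm => [|[|//]] _.
    exists (ball k.+1 k.+1), (ball k.+1 k).
    rewrite !card_ball kkn0 !addn0; split=> //; first exact: (ball_sub _ k.+1).
    exact: (ball_sub_full _ k.+1).
  (* The all-true vertex is full but left out of [I], matching the value [2 ^ k.+1 - 1] of [harper]
     on the whole cube. *)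
  exists setT, (ball k.+1 k.+1); split; rewrite ?subsetT //.
  - by apply/subsetP => v _; rewrite full_verticesE !inE; apply/forallP => c; rewrite inE.
  - by rewrite cardsT card_ffun card_bool card_ord -ball_card_full ball_cardS binn.
  - by rewrite card_ball -Bk -kk_bin bin0.
have {}ik : i < k by lia.
rewrite binS in hm.
have subk : k.+1 - i.+1 = (k - i.+1).+1 by lia.
(* The cases mirror the recursion of [kk]: the half with [v ord0 = true] is enlarged first and, once
   it is the ball of index [i.+1], the other half. *)
case: (leqP m 'C(k, i)) => him.
  have [A [I [bA Ib IA cA cI]]] := IHk i m (ltnW ik) him.
  exists (join (ball k i.+1) A), (join (ball k i) I).
  rewrite !card_join !card_ball cA cI; split.
  - by rewrite ballS; apply: subset_slices => -[]; rewrite !slice_join.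
  - by rewrite ballS; apply: subset_slices => -[]; rewrite !slice_join //; exact: (ball_sub _ i.+1).
  - apply: subset_slices => -[]; rewrite slice_full !slice_join subsetI.
      by rewrite IA (subset_trans Ib (ball_sub _ i.+1)).
    by rewrite bA (ball_sub_full k i.+1).
  - by rewrite ball_cardSl /= addnA.
  - rewrite ball_cardSl /= addnA; congr (_ + _).
    by rewrite subSS -subnSK // kkS_le // subnSK // bin_sub // ltnW.
have [r Er] : exists r, m = 'C(k, i) + r by exists (m - 'C(k, i)); lia.
have [A [I [bA Ib IA cA cI]]] := IHk i.+1 r ik ltac:(lia).
exists (join A (ball k i.+1)), (join I (ball k i)).
rewrite !card_join !card_ball cA cI; split.
- by rewrite ballS; apply: subset_slices => -[]; rewrite !slice_join //; exact: (ball_sub _ i.+1).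
- by rewrite ballS; apply: subset_slices => -[]; rewrite !slice_join.
- apply: subset_slices => -[]; rewrite slice_full !slice_join subsetI.
    by rewrite (ball_sub_full k i.+1) (subset_trans (ball_sub _ i.+1) bA).
  by rewrite IA Ib.
- by rewrite ball_cardSl /= !ball_cardS; lia.
- have := kkS_add k (k - i.+1) r; rewrite subnSK // bin_sub ?(ltnW ik) // -Er subSS => ->.
  by have := ball_card_pred (ltnW ik); rewrite ball_cardSl /= -(subnSK ik); lia.
Qed.

Theorem theorem2 (k n i m : nat)
  (k_ge1 : 1 <= k)
  (n_range : 1 <= n <= 2 ^ k - 1)
  (i_range : 0 <= i <= k - 1)
  (m_range : 0 <= m < 'C(k, i.+1))
  (n_repr : n = \sum_(0 <= l < i.+1) 'C(k, l) + m) :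
  phi k n = \sum_(0 <= l < i) 'C(k, l) + upper_boundary m (k - i - 1).
Proof.
have ik : i < k by lia.
have /andP[_ hm] := m_range.
(* Since [m < 'C(k, i.+1)], [kk] may replace [upper_boundary]; the right-hand side is then
   [harper k n]. *)
rewrite -subnDA addn1 -(@kk_upper_boundary k) ?bin_sub //.
have := harperE ik (ltnW hm); rewrite /= /ball_card => <-; rewrite -n_repr.
apply/eqP; rewrite eqn_leq; apply/andP; split.
  by apply/bigmax_leqP => S /eqP cS; rewrite -cS card_full_le_harper // cS; lia.
have [A [I [_ _ IA cA cI]]] := exists_harper_set ik (ltnW hm).
have -> : harper k n = #|I|.
  by rewrite n_repr -/(ball_card k i.+1) harperE ?(ltnW hm) // cI.
have An : #|A| == n by rewrite cA n_repr.
apply: leq_trans (subset_leq_card IA) _.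
exact: (leq_bigmax_cond (F := fun S : {set cube k} => #|full_vertices S|) A An).
Qed.
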